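(* Let $S\subseteq\mathbb{R}^n$ be a polyhedrally-truncated affine lattice. Suppose $\{B_t\}_{t=1}^\infty$ is a sequence of maximal $S$-free sets (with the origin in their interiors) possessing the covering property. If $B_t\to B$, where $B$ is a maximal $S$-free set (with the origin in its interior) and $B\cap\operatorname{conv}(S)$ is a polytope, then $B$ also possesses the covering property.
   Context: A lattice in $\mathbb{R}^n$ is a set $\Lambda=\{\lambda_1v_1+\dots+\lambda_nv_n:\lambda_i\in\mathbb{Z}\}$ with $v_1,\dots,v_n\in\mathbb{R}^n$ linearly independent. A truncated affine lattice is a set $S=(b+\Lambda)\cap C$ with $\Lambda$ a lattice in $\mathbb{R}^n$, $b\in\mathbb{R}^n\setminus\Lambda$ and $C\subseteq\mathbb{R}^n$ convex; it is polyhedrally-truncated if $\operatorname{conv}(S)$ is a polyhedron. A convex set $B$ is $S$-free if $\operatorname{int}(B)\cap S=\emptyset$, and maximal $S$-free if it is inclusion-wise maximal among $S$-free convex sets. A maximal $S$-free set with the origin in its interior is a polyhedron of the form $\{r:a_i\cdot r\le 1,\ i\in I\}$ with $I$ finite. Convergence $B_t\to B$: there is a fixed finite index set $I$ and vectors $a_i^t,a_i\in\mathbb{R}^n$ ($i\in I$, $t\in\mathbb{N}$) such that $B_t=\{x:a_i^t\cdot x\le 1,\ i\in I\}$, $B=\{x:a_i\cdot x\le 1,\ i\in I\}$, and $a_i^t\to a_i$ as $t\to\infty$ for each $i\in I$. Covering property: let $B$ be maximal $S$-free with the origin in its interior, described by facet-defining inequalities $B=\{r:c_j\cdot r\le 1,\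 j\in J\}$ ($J$ finite, exactly one inequality per facet). For $s\in B\cap S$, choose $k\in J$ with $c_k\cdot s=1$ (such $k$ exists, and the following set does not depend on the choice) and let $R(s,B)=\{r:(c_j-c_k)\cdot r\le 0,\ (c_j-c_k)\cdot(s-r)\le 0\ \forall j\in J\}$. Let $R(S,B)=\bigcup_{s\in B\cap S}R(s,B)$ and $W_S=\{w\in\mathbb{R}^n:s+\lambda w\in S\ \forall s\in S,\ \forall\lambda\in\mathbb{Z}\}$. Then $B$ has the covering property if $R(S,B)+W_S=\mathbb{R}^n$ (Minkowski sum). *)

(* Defs.v *)
From mathcomp Require Import all_boot all_order all_algebra.
From mathcomp Require Import all_classical all_reals all_analysis.
Import numFieldNormedType.Exports.

Set Implicit Arguments.
Unset Strict Implicit.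
Unset Printing Implicit Defensive.

Import Order.TTheory GRing.Theory Num.Theory.

Local Open Scope classical_set_scope.
Local Open Scope ring_scope.

(* Points of R^n are row vectors, with the library's max-norm topology, which
   is the Euclidean topology. *)

Section Definitions.
Variables (R : realType) (n : nat).
Implicit Types (A B C F L P S : set 'rV[R]_n) (r s w x y : 'rV[R]_n).

Definition dotp x y : R := \sum_i x 0 i * y 0 i.

Definition is_convex A : Prop := convex_set (M := 'rV[R]_n) A.

Definition convex_hull A : set 'rV[R]_n := smallest is_convex A.

Definition polyhedron P : Prop :=
  exists m (a : 'I_m -> 'rV[R]_n) (beta : 'I_m -> R),
    P = [set x | forall i, dotp (a i) x <= beta i].

Definition polytope P : Prop := polyhedron P /\ bounded_set P.

Definition lattice L : Prop :=
  exists2 V : 'M[R]_n, row_free V &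
    L = [set \sum_i row i V *~ z i | z in [set: 'I_n -> int]].

Definition truncated_affine_lattice S : Prop :=
  exists L b C, [/\ lattice L, ~ L b, is_convex C &
    S = [set b + l | l in L] `&` C].

Definition polyhedrally_truncated_affine_lattice S : Prop :=
  truncated_affine_lattice S /\ polyhedron (convex_hull S).

Definition free_of S B : Prop := is_convex B /\ interior B `&` S = set0.

Definition maximal_free S B : Prop :=
  free_of S B /\ forall B', free_of S B' -> B `<=` B' -> B' = B.

Definition polar_polyhedron m (a : 'I_m -> 'rV[R]_n) : set 'rV[R]_n :=
  [set x | forall i, dotp (a i) x <= 1].

Definition polyhedra_cvg (Bt : nat -> set 'rV[R]_n) B : Prop :=
  exists m (at_ : nat -> 'I_m -> 'rV[R]_n) (a : 'I_m -> 'rV[R]_n),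
    [/\ forall t, Bt t = polar_polyhedron (at_ t),
        B = polar_polyhedron a &
        forall i, at_ t i @[t --> \oo] --> a i].

Definition affinely_independent m (p : 'I_m -> 'rV[R]_n) : Prop :=
  forall l : 'I_m -> R,
    \sum_i l i = 0 -> \sum_i l i *: p i = 0 -> forall i, l i = 0.

Definition has_affine_points A m : Prop :=
  exists p : 'I_m -> 'rV[R]_n, affinely_independent p /\ forall i, A (p i).

(* The empty set, of dimension -1, satisfies this for no d. *)
Definition affine_dim A (d : nat) : Prop :=
  has_affine_points A d.+1 /\ ~ has_affine_points A d.+2.

Definition face B F : Prop :=
  exists a (beta : R), (forall x, B x -> dotp a x <= beta) /\
    F = B `&` [set x | dotp a x = beta].

Definition facet B F : Prop :=
  face B F /\ exists d, affine_dim F d /\ affine_dim B d.+1.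

Definition facet_description B m (c : 'I_m -> 'rV[R]_n) : Prop :=
  let Fc j := B `&` [set x | dotp (c j) x = 1] in
  [/\ B = polar_polyhedron c,
      forall j, facet B (Fc j) &
      forall F, facet B F -> exists! j, F = Fc j].

Definition spindle m (c : 'I_m -> 'rV[R]_n) (k : 'I_m) s : set 'rV[R]_n :=
  [set r | forall j, dotp (c j - c k) r <= 0 /\ dotp (c j - c k) (s - r) <= 0].

(* R(S,B): for s in B, spindle c k s does not depend on which k with
   c_k . s = 1 is used, so taking all of them amounts to choosing one. *)
Definition lifting_region S B m (c : 'I_m -> 'rV[R]_n) : set 'rV[R]_n :=
  \bigcup_(s in B `&` S) \bigcup_(k in [set k | dotp (c k) s = 1])
    spindle c k s.

Definition lineality_lattice S : set 'rV[R]_n :=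
  [set w | forall s, S s -> forall z : int, S (s + w *~ z)].

(* When 0 is interior to B, the facet description of B is unique up to
   reindexing, so the existential over c involves no choice. *)
Definition covering_property S B : Prop :=
  exists m (c : 'I_m -> 'rV[R]_n), facet_description B c /\
    [set r + w | r in lifting_region S B c & w in lineality_lattice S] = setT.

End Definitions.

(* Main.v *)
Require Import Defs.
From mathcomp Require Import all_boot all_order all_algebra.
From mathcomp Require Import all_classical all_reals all_analysis.
From mathcomp Require Import ring lra.
Import numFieldNormedType.Exports.
Import Order.TTheory GRing.Theory Num.Theory.
Local Open Scope classical_set_scope.
Local Open Scope ring_scope.

(** Write B_t = {x : a_i^t . x <= 1} and B = {x : a_i . x <= 1} with a_i^t -> a_i,
    and fix an ultrafilter on the indices t that refines convergence to infinity,
    so that bounded families converge and families with finitely many values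
    are constant.

    Every facet normal of B_t is one of the a_i^t (facet_normal), and the set J
    of indices that give facets of B_t may be taken independent of t. In the
    limit the inequalities of J still describe B (polar_cvg_subpolar), but some
    may have become redundant: facets of B_t can merge or vanish. The covering
    property is therefore reformulated for a description that may have redundant
    inequalities (covering_propertyP); the only delicate point is a spindle based
    at a redundant normal, which is also based at a facet normal
    (tight_normal_above).

    Given x, the covering property of B_t provides s_t in S and B_t, a point r_t
    of its spindle and w_t in W_S with x = r_t + w_t. It suffices that s_t and
    w_t converge (covers_at_cvg), since S is closed and so is every condition on
    (s, r, w). If one of them were unbounded, its limit direction would produce
    a ray in B and conv S, against the assumption that this intersection is
    a polytope. To start such a ray one needs a point of B and conv S. It exists
    by maximality of B: otherwise the two polyhedra would be separated with a
    gap, by the Farkas lemma, and B would be contained in a larger S-free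
    half-space (maximal_free_meets_hull). *)

Set Implicit Arguments.
Unset Strict Implicit.

(** * The scalar product and convex sets *)

Section Dotp.
Variables (R : realType) (n : nat).
Implicit Types (x y z : 'rV[R]_n) (l : R).

Lemma dotpE x y : dotp x y = (x *m y^T) 0 0.
Proof. by rewrite mxE; apply: eq_bigr => i _; rewrite mxE. Qed.

Lemma dotpC x y : dotp x y = dotp y x.
Proof. by apply: eq_bigr => i _; rewrite mulrC. Qed.

Lemma dotpDl x y z : dotp (x + y) z = dotp x z + dotp y z.
Proof. by rewrite !dotpE mulmxDl mxE. Qed.

Lemma dotpDr x y z : dotp z (x + y) = dotp z x + dotp z y.
Proof. by rewrite !(dotpC z) dotpDl. Qed.

Lemma dotpZl l x y : dotp (l *: x) y = l * dotp x y.
Proof. by rewrite !dotpE -scalemxAl mxE. Qed.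

Lemma dotpZr l x y : dotp x (l *: y) = l * dotp x y.
Proof. by rewrite !(dotpC x) dotpZl. Qed.

Lemma dotpNl x y : dotp (- x) y = - dotp x y.
Proof. by rewrite -scaleN1r dotpZl mulN1r. Qed.

Lemma dotpNr x y : dotp x (- y) = - dotp x y.
Proof. by rewrite !(dotpC x) dotpNl. Qed.

Lemma dotpBl x y z : dotp (x - y) z = dotp x z - dotp y z.
Proof. by rewrite dotpDl dotpNl. Qed.

Lemma dotpBr x y z : dotp z (x - y) = dotp z x - dotp z y.
Proof. by rewrite dotpDr dotpNr. Qed.

Lemma dotp0l y : dotp 0 y = 0.
Proof. by rewrite -(scale0r y) dotpZl mul0r. Qed.

Lemma dotp0r y : dotp y 0 = 0.
Proof. by rewrite dotpC dotp0l. Qed.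

Lemma dotp_suml (I : finType) (P : pred I) (f : I -> 'rV[R]_n) y :
  dotp (\sum_(i | P i) f i) y = \sum_(i | P i) dotp (f i) y.
Proof.
by apply: (big_morph (fun x => dotp x y)) => [u v|]; rewrite ?dotpDl ?dotp0l.
Qed.

Lemma dotp_sumr (I : finType) (P : pred I) (f : I -> 'rV[R]_n) y :
  dotp y (\sum_(i | P i) f i) = \sum_(i | P i) dotp y (f i).
Proof.
by rewrite dotpC dotp_suml; apply: eq_bigr => i _; rewrite dotpC.
Qed.

Lemma dotp_delta x i : dotp x (delta_mx 0 i) = x 0 i.
Proof.
rewrite /dotp (bigD1 i) //= mxE !eqxx mulr1 big1 ?addr0 // => j ji.
by rewrite mxE (negPf ji) andbF mulr0.
Qed.

Lemma dotp_gt0 x : x != 0 -> 0 < dotp x x.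
Proof.
move=> x0; rewrite lt_def; apply/andP; split; last first.
  by apply: sumr_ge0 => i _; rewrite -expr2 sqr_ge0.
apply: contra x0 => /eqP d0; apply/eqP/rowP => i; rewrite mxE.
have sq j : true -> 0 <= x 0 j * x 0 j by rewrite -expr2 sqr_ge0.
have /eqP : x 0 i * x 0 i = 0 by exact: (psumr_eq0P sq d0).
by rewrite mulf_eq0 orbb => /eqP.
Qed.

Lemma cvg_dotp (T : Type) (F : set_system T) (FF : Filter F)
    (f g : T -> 'rV[R]_n) x y :
  f @ F --> x -> g @ F --> y -> dotp (f t) (g t) @[t --> F] --> dotp x y.
Proof.
move=> fx gy.
have coord (h : T -> 'rV[R]_n) z i : h @ F --> z -> h t 0 i @[t --> F] --> z 0 i.
  by move=> hz; exact: (cvg_comp _ _ hz (@coord_continuous R 1 n 0 i z)).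
apply: cvg_big => [|i _]; first exact: add_continuous.
by apply: cvgM; exact: coord.
Qed.

End Dotp.

(** Read with s = - b and t = 1, the right-hand side is the excess of y in the
    affine inequality x . y <= b: an extra coordinate makes affine conditions
    linear. *)
Lemma dotp_homogenized (R : realType) n (x y : 'rV[R]_n) (s t : R) :
  dotp (row_mx x s%:M) (row_mx y t%:M) = dotp x y + s * t.
Proof.
rewrite /dotp big_split_ord /= big_ord1; congr (_ + _).
  by apply: eq_bigr => i _; rewrite !row_mxEl.
by rewrite !row_mxEr !mxE eqxx !mulr1n.
Qed.

Section Convex.
Variables (R : realType) (n : nat).
Implicit Types (A : set 'rV[R]_n) (x y : 'rV[R]_n) (l : R).

Lemma is_convexP A :
  is_convex A <-> forall x y l, 0 <= l <= 1 -> A x -> A y ->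
    A (l *: x + (1 - l) *: y).
Proof.
split=> [cA x y l /andP[l0 l1] Ax Ay|cA x y l].
  have := cA x y (Itv01 l0 l1); rewrite !inE; exact.
by rewrite !inE => Ax Ay; apply: cA => //; rewrite ge0 le1.
Qed.

Lemma convex_hull_convex A : is_convex (convex_hull A).
Proof.
move=> x y l; rewrite !inE => hx hy C [cC AC].
by have := cC x y l; rewrite !inE; apply; [apply: hx|apply: hy].
Qed.

Lemma sub_convex_hull A : A `<=` convex_hull A.
Proof. by move=> x Ax C [_]; apply. Qed.

Lemma convex_halfspace (a : 'rV[R]_n) (b : R) :
  is_convex [set x | dotp a x <= b].
Proof.
apply/is_convexP => x y l /andP[l0 l1] /= ax ay.
rewrite dotpDr !dotpZr.
have : l * dotp a x <= l * b by apply: ler_wpM2l.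
have : (1 - l) * dotp a y <= (1 - l) * b by apply: ler_wpM2l => //; lra.
lra.
Qed.

Lemma closed_halfspace (a : 'rV[R]_n) (b : R) : closed [set x | dotp a x <= b].
Proof.
have cont x : dotp a @ x --> dotp a x.
  have := @cvg_dotp R n _ (nbhs x) _ (fun=> a) id a x (cvg_cst a).
  by apply; exact: cvg_id.
exact: (@preimage_closed _ _ (dotp a) _ (fun x _ => cont x) (@closed_le R b)).
Qed.

Lemma polyhedron_closed (P : set 'rV[R]_n) : polyhedron P -> closed P.
Proof.
move=> [m [a [b ->]]].
rewrite (_ : [set _ | _] = \bigcap_(i in setT) [set x | dotp (a i) x <= b i]).
  by apply: closed_bigI => i _; exact: closed_halfspace.
by rewrite eqEsubset; split=> x /= h => [i _|i]; [apply: h|apply: (h i)].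
Qed.

Lemma bounded_ray A x u :
  bounded_set A -> (forall l, 0 <= l -> A (x + l *: u)) -> u = 0.
Proof.
move=> [M [_ bM]] ray; apply/eqP/negPn/negP => u0.
(* Points at distance more than K from 0 lie outside A. *)
pose K := `|M| + 1.
have KM : M < K by rewrite /K (le_lt_trans (ler_norm M)) // ltrDl.
have K0 : 0 <= K by rewrite /K addr_ge0.
have l0 : 0 <= (K + `|x| + 1) / `|u| by rewrite divr_ge0 ?addr_ge0.
have := bM _ KM _ (ray _ l0).
set l := _ / _ in l0 *.
have lu : `|l *: u| = K + `|x| + 1.
  by rewrite normrZ (ger0_norm l0) /l divfK // normr_eq0.
have := ler_normB (x + l *: u) x; rewrite addrC addKr lu => h1 /= h2.
lra.
Qed.

End Convex.

(** * Separation of disjoint polyhedra *)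

(** Induction on the number of inequalities. If the inequality of a 0 cannot be
    dropped, some x satisfies the others while b x > 0, and then a 0 x > 0.
    Composing all functionals with the projection along x onto the kernel of
    a 0 gives an instance with one inequality fewer; its multipliers lift, and
    the coefficient of a 0 that they force is nonnegative by the choice of x. *)
Lemma farkas (R : realType) (n m : nat) (a : 'I_m -> 'rV[R]_n) (b : 'rV[R]_n) :
  (forall x, (forall i, dotp (a i) x <= 0) -> dotp b x <= 0) ->
  exists2 l : 'I_m -> R, forall i, 0 <= l i & b = \sum_i l i *: a i.
Proof.
elim: m a b => [|m IH] a b ab.
  exists (fun=> 0) => //; rewrite big_ord0; apply/eqP/negPn/negP => b0.
  have := ab b (fun i => False_ind _ (notF (ltn_ord i))).
  by rewrite leNgt dotp_gt0.
have [ab'|/existsNP[x /not_implyP[ax /negP]]] := pselect (forall x,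
    (forall i, dotp (a (lift ord0 i)) x <= 0) -> dotp b x <= 0).
  have [l l0 ->] := IH _ _ ab'.
  exists (fun i => if unlift ord0 i is Some j then l j else 0) => [i|].
    by case: unliftP.
  rewrite big_ord_recl unlift_none scale0r add0r.
  by apply: eq_bigr => i _; rewrite liftK.
rewrite -ltNge => bx.
have e0 : 0 < dotp (a ord0) x.
  rewrite ltNge; apply: contraPN bx => a0; apply/negP; rewrite -leNgt.
  by apply: ab => i; case: (unliftP ord0 i) => [j|] ->.
set e := dotp _ _ in e0.
pose proj (v : 'rV[R]_n) := v - (dotp v x / e) *: a ord0.
have projE v y : dotp (proj v) y = dotp v (y - (dotp (a ord0) y / e) *: x).
  by rewrite dotpBl dotpZl dotpBr dotpZr; ring.
have [|l l0 bE] := IH (fun i => proj (a (lift ord0 i))) (proj b).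
  move=> y ay; rewrite projE; apply: ab => i.
  case: (unliftP ord0 i) => [j|] ->; first by rewrite -projE.
  by rewrite dotpBr dotpZr -/e divfK ?subrr // gt_eqF.
pose l1 := (dotp b x - \sum_i l i * dotp (a (lift ord0 i)) x) / e.
exists (fun i => if unlift ord0 i is Some j then l j else l1) => [i|].
  case: unliftP => [//|_]; rewrite divr_ge0 ?(ltW e0) // subr_ge0.
  apply: le_trans (ltW bx); apply: sumr_le0 => j _.
  by rewrite mulr_ge0_le0.
rewrite big_ord_recl unlift_none.
under eq_bigr do rewrite liftK.
rewrite -[LHS](subrK ((dotp b x / e) *: a ord0)) -/(proj b) bE /proj.
under [X in X + _ = _]eq_bigr do rewrite scalerBr.
rewrite sumrB -addrA addrC; congr (_ + _).
rewrite addrC /l1 mulrBl scalerBl; congr (_ - _).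
rewrite mulr_suml scaler_suml; apply: eq_bigr => i _.
by rewrite scalerA mulrA.
Qed.

(** Two disjoint polyhedra are at positive distance, which fails for general
    closed convex sets. Homogenized with a last coordinate t, disjointness says
    that the two systems together force t <= 0; the Farkas multipliers write
    the functional t as a combination of both systems, and the part that comes
    from the first system is the separating functional. Evaluation at t = 1
    gives the gap. *)
Lemma polyhedra_separation (R : realType) (n m p : nat)
    (a : 'I_m -> 'rV[R]_n) (b : 'I_m -> R)
    (d : 'I_p -> 'rV[R]_n) (c : 'I_p -> R) :
  [set x | forall i, dotp (a i) x <= b i] `&`
    [set x | forall i, dotp (d i) x <= c i] = set0 ->
  exists f (beta : R),
    (forall x, (forall i, dotp (a i) x <= b i) -> dotp f x <= beta) /\
    (forall x, (forall i, dotp (d i) x <= c i) -> beta + 1 <= dotp f x).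
Proof.
move=> disj.
pose hom (v : 'rV[R]_n) (r : R) : 'rV[R]_(n + 1) := row_mx v (- r)%:M.
have homE v r x (t : R) : dotp (hom v r) (row_mx x t%:M) = dotp v x - r * t.
  by rewrite dotp_homogenized mulNr.
pose g (k : 'I_(m + p)) :=
  match fintype.split k with inl i => hom (a i) (b i) | inr j => hom (d j) (c j) end.
have gl i : g (lshift p i) = hom (a i) (b i) by rewrite /g (unsplitK (inl i)).
have gr j : g (rshift m j) = hom (d j) (c j) by rewrite /g (unsplitK (inr j)).
have [|l l0 lE] := @farkas R (n + 1) (m + p) g (hom 0 (-1)).
  move=> y gy; pose x := lsubmx y; pose t := rsubmx y 0 0.
  have yE : y = row_mx x t%:M by rewrite -mx11_scalar hsubmxK.
  rewrite yE homE dotp0l mulN1r opprK add0r leNgt; apply/negP => t0.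
  have : set0 (t^-1 *: x); last by [].
  rewrite -disj; split=> i /=; rewrite dotpZr ler_pdivrMl //.
    by have := gy (lshift p i); rewrite gl yE homE subr_le0 mulrC.
  by have := gy (rshift m i); rewrite gr yE homE subr_le0 mulrC.
exists (\sum_i l (lshift p i) *: a i), (\sum_i l (lshift p i) * b i).
have fE x : dotp (\sum_i l (lshift p i) *: a i) x - \sum_i l (lshift p i) * b i
    = \sum_i l (lshift p i) * (dotp (a i) x - b i).
  rewrite dotp_suml -sumrB; apply: eq_bigr => i _.
  by rewrite dotpZl mulrBr.
split=> x hx; first rewrite -subr_le0 fE.
  by apply: sumr_le0 => i _; rewrite mulr_ge0_le0 // subr_le0.
rewrite -lerBrDl fE.
have := congr1 (fun v => dotp v (row_mx x 1%:M)) lE.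
rewrite /= homE dotp0l mulr1 opprK add0r dotp_suml big_split_ord /= => ->.
under [X in X + _]eq_bigr do rewrite dotpZl gl homE mulr1.
under [X in _ + X]eq_bigr do rewrite dotpZl gr homE mulr1.
by rewrite gerDl; apply: sumr_le0 => i _; rewrite mulr_ge0_le0 // subr_le0.
Qed.

(** * Facets of a polyhedron with the origin in its interior *)

Section Affine.
Variables (R : realType) (n : nat).
Implicit Types (A F : set 'rV[R]_n) (a : 'rV[R]_n).

Lemma affinely_independent_row_free m (p : 'I_m -> 'rV[R]_n) :
  affinely_independent p ->
  row_free (\matrix_i row_mx (p i) (1%:M : 'M[R]_1)).
Proof.
move=> pi; apply: inj_row_free => v; set M := \matrix_i _ => vM0.
have vME j : \sum_i v 0 i * row_mx (p i) (1%:M : 'M[R]_1) 0 j = 0.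
  have := congr1 (fun w : 'rV[R]_(n + 1) => w 0 j) vM0; rewrite mxE [RHS]mxE => vMj.
  by rewrite -[RHS]vMj; apply: eq_bigr => i _; rewrite [M i j]mxE.
apply/rowP => i; rewrite mxE; apply: pi.
  rewrite -[RHS](vME (rshift n 0)); apply: eq_bigr => k _.
  by rewrite row_mxEr mxE eqxx mulr1.
apply/rowP => j; rewrite summxE mxE -[RHS](vME (lshift 1 j)).
by apply: eq_bigr => k _; rewrite row_mxEl mxE.
Qed.

Lemma affine_points_le A m : has_affine_points A m -> (m <= n.+1)%N.
Proof.
move=> [p [/affinely_independent_row_free pf _]].
by rewrite -addn1 -(eqP pf) rank_leq_col.
Qed.

Let hyp (a : 'rV[R]_n) (b : R) : 'rV[R]_(n + 1) := row_mx a (- b)%:M.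

Let hyp_neq0 a b : a != 0 -> hyp a b != 0.
Proof.
by apply: contra => /eqP; rewrite -(row_mx0 _ 1 n 1) => /eq_row_mx[->].
Qed.

Let mul_hyp m (p : 'I_m -> 'rV[R]_n) a b :
  (forall i, dotp a (p i) = b) ->
  (\matrix_i row_mx (p i) (1%:M : 'M[R]_1)) *m (hyp a b)^T = 0.
Proof.
move=> pa; apply/matrixP => i j; rewrite [RHS]mxE.
transitivity (dotp (row_mx (p i) 1%:M) (hyp a b)).
  by rewrite mxE; apply: eq_bigr => k _; rewrite mxE [_^T _ _]mxE ord1.
by rewrite dotp_homogenized mul1r dotpC pa subrr.
Qed.

(** The rows (p i, 1) are linearly independent and orthogonal to the nonzero
    vector (a, - b) of R^(n+1). *)
Lemma affine_points_hyperplane A m a b :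
  a != 0 -> A `<=` [set x | dotp a x = b] -> has_affine_points A m ->
  (m <= n)%N.
Proof.
move=> a0 Aab [p [pi pA]]; have pf := affinely_independent_row_free pi.
have /mulmx0_rank_max := mul_hyp (fun i => Aab _ (pA i)).
by rewrite (eqP pf) mxrank_tr rank_rV hyp_neq0 // addn1 addn1 ltnS.
Qed.

(** The vectors orthogonal to the n independent rows (p i, 1) of R^(n+1) form
    a line, which is spanned by (a, - b). *)
Lemma affine_points_hyperplane_unique m (p : 'I_m -> 'rV[R]_n) a b a' b' :
  a != 0 -> (n <= m)%N -> affinely_independent p ->
  (forall i, dotp a (p i) = b) -> (forall i, dotp a' (p i) = b') ->
  exists l, a' = l *: a /\ b' = l * b.
Proof.
move=> a0 nm /affinely_independent_row_free pf pa pa'.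
have : (\matrix_i row_mx (p i) (1%:M : 'M[R]_1)) *m
    (col_mx (hyp a b) (hyp a' b'))^T = 0.
  by rewrite tr_col_mx mul_mx_row (mul_hyp pa) (mul_hyp pa') row_mx0.
move=> /mulmx0_rank_max; rewrite (eqP pf) mxrank_tr => rk.
have : (hyp a b <= col_mx (hyp a b) (hyp a' b'))%MS by rewrite -addsmxE addsmxSl.
move=> /mxrank_leqif_sup /leqifP; case: ifP => [|_].
  rewrite -addsmxE addsmx_sub submx_refl => /= /sub_rVP[l hl] _.
  exists l; have : hyp a' b' = hyp (l *: a) (l * b).
    by rewrite hl /hyp scale_row_mx scale_scalar_mx mulrN.
  move=> /eq_row_mx[-> /(congr1 (fun M : 'M[R]_1 => M 0 0))].
  by rewrite !mxE !mulr1n => /oppr_inj ->.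
rewrite rank_rV hyp_neq0 // => rk1.
by have := leq_ltn_trans (leq_add nm rk1) (leq_ltn_trans rk (ltnSn _));
  rewrite addn2 addn1 ltnn.
Qed.

Lemma has_affine_points_leq A m k :
  (k <= m)%N -> has_affine_points A m -> has_affine_points A k.
Proof.
move=> km [p [pi pA]]; exists (p \o widen_ord km); split=> [l l0 lp i|i //=].
pose L j := \sum_(i' | widen_ord km i' == j) l i'.
have <- : L (widen_ord km i) = l i.
  rewrite /L (bigD1 i) //= big1 ?addr0 // => j /andP[/eqP /val_eqP /= ij].
  by rewrite -val_eqE /= (eqP ij) eqxx.
apply: pi.
  by rewrite -[RHS]l0 [RHS](partition_big (widen_ord km) xpredT).
rewrite -[RHS]lp [RHS](partition_big (widen_ord km) xpredT) //=.
apply: eq_bigr => j _; rewrite scaler_suml.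
by apply: eq_bigr => i' /eqP <-.
Qed.

End Affine.

(** The form in which openness is used for a finite system: a point strictly
    inside some of the inequalities can be moved in finitely many prescribed
    directions at once. *)
Lemma small_step (R : realType) (I : finType) (P : pred I) (x c : I -> R) :
  (forall i, P i -> x i < 1) ->
  exists2 e, 0 < e & forall i, P i -> x i + e * c i < 1.
Proof.
move=> x1; have : \forall e \near (0 : R)^'+, forall i, P i -> x i + e * c i < 1.
  apply: filter_forall => i; case Pi : (P i); last exact: nearW.
  have : x i + e * c i @[e --> (0 : R)^'+] --> x i + 0 * c i.
    apply: cvgD; first exact: cvg_cst.
    by apply: cvgMr_tmp; apply: cvg_at_right_filter; exact: cvg_id.
  rewrite mul0r addr0 => /cvgr_lt /(_ _ (x1 i Pi)).
  by apply: filterS => e.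
move=> /(filterI (nbhs_right_gt (0 : R))) /filter_ex[e [e0 he]].
by exists e.
Qed.

Section PolarFacets.
Variables (R : realType) (n m : nat) (a : 'I_m -> 'rV[R]_n).
Implicit Types (v x y z : 'rV[R]_n).

(** If every inequality were slack at z, one could move from z in the direction
    v and increase v . x beyond b. *)
Lemma tight_normal v b z : polar_polyhedron a z ->
  (forall x, polar_polyhedron a x -> dotp v x <= b) -> dotp v z = b ->
  v != 0 -> exists j, dotp (a j) z = 1.
Proof.
move=> az vb vz v0; apply: contrapT => /forallNP tz.
have [i _|e e0 he] := @small_step R 'I_m xpredT
    (fun i => dotp (a i) z) (fun i => dotp (a i) v).
  by rewrite lt_neqAle az andbT; apply/eqP.
have /vb : polar_polyhedron a (z + e *: v).
  by move=> i; rewrite dotpDr dotpZr; apply/ltW/he.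
by rewrite dotpDr vz dotpZr gerDl leNgt mulr_gt0 // dotp_gt0.
Qed.

(** The origin is interior to the polyhedron: take 0 and small multiples of
    the unit vectors. *)
Lemma polar_affine_points : has_affine_points (polar_polyhedron a) n.+1.
Proof.
have [//|e e0 he] := @small_step R ('I_m * 'I_n)%type xpredT
    (fun=> 0) (fun ik => a ik.1 0 ik.2).
exists (fun k => if unlift ord0 k is Some i then e *: delta_mx 0 i else 0).
split=> [l|k j]; last first.
  case: unliftP => [i|] _; last by rewrite dotp0r.
  by rewrite dotpZr dotp_delta; apply: ltW; have := he (j, i) isT; rewrite add0r.
rewrite !big_ord_recl unlift_none scaler0 add0r.
under [in X in _ -> X -> _]eq_bigr do rewrite liftK.
move=> l0 /rowP lv.
have lk (k : 'I_n) : l (lift ord0 k) = 0.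
  have := lv k; rewrite summxE mxE (bigD1 k) //= big1 ?addr0 => [|i ik].
    by rewrite !mxE !eqxx mulr1 => /eqP; rewrite mulf_eq0 (gt_eqF e0) orbF => /eqP.
  by rewrite !mxE (eq_sym k) (negPf ik) andbF !mulr0.
move=> i; case: (unliftP ord0 i) => [j ->//|->].
by move: l0; rewrite big1 ?addr0.
Qed.

Lemma polar_affine_dim d : affine_dim (polar_polyhedron a) d -> d = n.
Proof.
move=> [/affine_points_le dn nd]; apply/eqP; rewrite eqn_leq -ltnS dn /=.
rewrite leqNgt; apply/negP => dn'; apply: nd.
by apply: has_affine_points_leq polar_affine_points.
Qed.

(** Each facet is cut out by one of the given inequalities: the barycentre of n
    affinely independent points of the facet is tight for some a j, which is then
    tight at all n points, and these span the hyperplane of the facet. *)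
Lemma facet_normal v b :
  let F := polar_polyhedron a `&` [set x | dotp v x = b] in
  (forall x, polar_polyhedron a x -> dotp v x <= b) ->
  facet (polar_polyhedron a) F -> exists2 j, v = b *: a j & b != 0.
Proof.
move=> F vb [_ [d [[Fd Fd'] /polar_affine_dim dn]]].
(* For v = 0 the set F would be the whole polyhedron, of dimension n. *)
have v0 : v != 0.
  apply/negP => /eqP v0; apply: Fd'.
  have [p [_ /(_ ord0)[_ /=]]] := Fd; rewrite v0 dotp0l => b0.
  rewrite /F v0 -b0 (_ : _ `&` _ = polar_polyhedron a).
    by rewrite dn; exact: polar_affine_points.
  by rewrite eqEsubset; split=> [x []//|x ax]; split=> //=; rewrite dotp0l.
case: Fd => p [pi pF].
pose q := (d.+1%:R : R)^-1 *: \sum_i p i.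
have N0 : (d.+1%:R : R) != 0 by rewrite pnatr_eq0.
have qE u : dotp u q = d.+1%:R^-1 * \sum_i dotp u (p i).
  by rewrite /q dotpZr dotp_sumr.
have aq : (d.+1%:R : R)^-1 * \sum_(i < d.+1) 1 = 1.
  by rewrite sumr_const card_ord mulVf.
have [||j jq] := @tight_normal v b q _ vb _ v0.
- move=> j; rewrite qE -[leRHS]aq ler_pM2l ?invr_gt0 ?ltr0Sn //.
  by apply: ler_sum => i _; case: (pF i) => /(_ j).
- rewrite qE (eq_bigr (fun=> b)) => [|i _]; last by case: (pF i).
  by rewrite sumr_const card_ord -[b *+ _]mulr_natl mulrA mulVf // mul1r.
(* The slacks of a j at the points p k are nonnegative with sum zero. *)
have jp i : dotp (a j) (p i) = 1.
  have h k : true -> 0 <= 1 - dotp (a j) (p k).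
    by rewrite subr_ge0; case: (pF k) => /(_ j).
  apply/eqP; rewrite eq_sym -subr_eq0; apply/eqP.
  apply: (psumr_eq0P h) => //; rewrite sumrB.
  apply: (mulfI (invr_neq0 N0)); rewrite mulr0 mulrBr aq -qE jq subrr //.
have aj0 : a j != 0.
  apply/eqP => aj; have := jp ord0; rewrite aj dotp0l => /eqP.
  by rewrite eq_sym oner_eq0.
have [||l [vl bl]] :=
  @affine_points_hyperplane_unique R n d.+1 p (a j) 1 v b aj0 _ pi jp.
- by rewrite dn.
- by move=> i; case: (pF i).
exists j; first by rewrite bl mulr1.
apply: contra v0 => /eqP b0; rewrite vl.
by move: bl; rewrite mulr1 b0 => <-; rewrite scale0r.
Qed.

(** The segment from 0 to a point that violates a j alone leaves the polyhedron
    through the relative interior of the facet of a j. *)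
Lemma irredundant_facet_point j y :
  1 < dotp (a j) y -> (forall i, i != j -> dotp (a i) y <= 1) ->
  exists2 z, dotp (a j) z = 1 & forall i, i != j -> dotp (a i) z < 1.
Proof.
move=> jy iy; have jy0 : 0 < dotp (a j) y by apply: lt_trans jy.
exists ((dotp (a j) y)^-1 *: y) => [|i ij].
  by rewrite dotpZr mulVf ?gt_eqF.
by rewrite dotpZr ltr_pdivrMl // mulr1 (le_lt_trans (iy i ij)).
Qed.

(** Around z the polyhedron agrees with the half-space of a j, so it contains
    z together with small steps along a basis of the hyperplane. *)
Lemma irredundant_facet j z :
  dotp (a j) z = 1 -> (forall i, i != j -> dotp (a i) z < 1) ->
  facet (polar_polyhedron a)
    (polar_polyhedron a `&` [set x | dotp (a j) x = 1]).
Proof.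
move=> jz iz; set F := _ `&` _.
have aj0 : a j != 0.
  apply/eqP => aj; have := jz; rewrite aj dotp0l => /eqP.
  by rewrite eq_sym oner_eq0.
have /rV0Pn[h ajh] := aj0.
have nS : n.-1.+1 = n by apply: prednK; apply: leq_ltn_trans (ltn_ord h).
split; first by exists (a j), 1; split=> // x; apply.
exists n.-1; rewrite /affine_dim nS; split; last first.
  split; first exact: polar_affine_points.
  by move=> /affine_points_le; rewrite ltnn.
split; last first.
  by move=> /(affine_points_hyperplane aj0 (@subIsetr _ _ _)); rewrite ltnn.
(* The vectors w k for k != h form a basis of the hyperplane, and w h = 0. *)
pose w (k : 'I_n) : 'rV[R]_n := delta_mx 0 k - (a j 0 k / a j 0 h) *: delta_mx 0 h.
have jw k : dotp (a j) (w k) = 0.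
  by rewrite dotpBr dotpZr !dotp_delta divfK ?subrr.
have [[i k] /= ij|e e0 he] := @small_step R ('I_m * 'I_n)%type
    (fun ik => ik.1 != j) (fun ik => dotp (a ik.1) z)
    (fun ik => dotp (a ik.1) (w ik.2)); first exact: iz.
have jp k : dotp (a j) (z + e *: w k) = 1.
  by rewrite dotpDr dotpZr jw mulr0 addr0.
exists (fun k => z + e *: w k); split=> [l l0 lp|k]; last first.
  split=> [i|/=]; last exact: jp.
  have [->|ij] := eqVneq i j; first by rewrite jp.
  by rewrite dotpDr dotpZr; apply: ltW; apply: (he (i, k)).
have lk k : k != h -> l k = 0.
  move=> kh; move: lp; under eq_bigr do rewrite scalerDr.
  rewrite big_split /= -scaler_suml l0 scale0r add0r => /rowP/(_ k).
  rewrite summxE (bigD1 k) //= big1 => [|i ik].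
    rewrite !mxE !eqxx (negPf kh) andbF !mulr0 subr0 addr0 mulr1 => /eqP.
    by rewrite mulf_eq0 (gt_eqF e0) orbF => /eqP.
  rewrite !mxE !(eq_sym k) (negPf ik) (eq_sym h) (negPf kh).
  by rewrite !andbF !mulr0 subr0 !mulr0.
move=> k; have [->|/lk//] := eqVneq k h.
by move: l0; rewrite (bigD1 h) //= big1 ?addr0.
Qed.

Lemma irredundant_facet_description :
  (forall j, exists2 y, 1 < dotp (a j) y &
    forall i, i != j -> dotp (a i) y <= 1) ->
  facet_description (polar_polyhedron a) a.
Proof.
move=> irr; split=> // [j|F].
  have [y jy iy] := irr j.
  by have [z] := irredundant_facet_point jy iy; exact: irredundant_facet.
move=> fF; have [[v [b [vb FE]]] _] := fF.
have := fF; rewrite {1}FE => /(facet_normal vb)[j vE b0].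
have {}FE : F = polar_polyhedron a `&` [set x | dotp (a j) x = 1].
  rewrite FE vE; congr (_ `&` _); apply/funext => x /=; apply/propext.
  rewrite dotpZl; split=> [|->]; last by rewrite mulr1.
  by rewrite -[RHS]mulr1 => /(mulfI b0).
exists j; split=> // k Fk; have [y jy iy] := irr j.
have [z jz iz] := irredundant_facet_point jy iy.
have : F z.
  rewrite FE; split=> // i; have [->|/iz/ltW//] := eqVneq i j.
  by rewrite jz.
rewrite Fk => -[_ /= kz]; apply/eqP; rewrite eq_sym; apply/negP => /negP /iz.
by rewrite kz ltxx.
Qed.

End PolarFacets.

(** Discarding redundant inequalities one at a time ends with the facets. *)
Lemma facet_description_exists (R : realType) n m (a : 'I_m -> 'rV[R]_n) :
  exists k (c : 'I_k -> 'rV[R]_n),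
    facet_description (polar_polyhedron a) c /\ forall j, exists i, c j = a i.
Proof.
elim: m a => [|m IH] a.
  exists 0%N, a; split=> [|[]//].
  by apply: irredundant_facet_description => -[].
have [irr|/existsNP[j /forallPNP red]] := pselect (forall j,
    exists2 y, 1 < dotp (a j) y & forall i, i != j -> dotp (a i) y <= 1).
  exists m.+1, a; split=> [|j]; last by exists j.
  exact: irredundant_facet_description.
have [k [c [cf ca]]] := IH (fun i => a (lift j i)).
exists k, c; split=> [|i]; last by have [i' ->] := ca i; exists (lift j i').
rewrite (_ : polar_polyhedron a = polar_polyhedron (fun i => a (lift j i))) //.
rewrite eqEsubset; split=> x ax i; first exact: ax.
have [i'|] := unliftP j i => ->; first exact: ax.
rewrite leNgt; apply/negP => jx; apply: (red x jx) => i' i'j.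
case: (unliftP j i') i'j => [i'' -> _|->]; first exact: ax.
by rewrite eqxx.
Qed.

(** * Limits along an ultrafilter *)

Section UltrafilterLimits.
Variables (T : Type) (U : set_system T).
Hypothesis UU : UltraFilter U.
Let PU : ProperFilter U := ultra_proper.

(** The pigeonhole principle without passing to a subsequence. *)
Lemma ultra_constant (I : finType) (f : T -> I) :
  exists i, \forall t \near U, f t = i.
Proof.
apply: contrapT => /forallNP fU.
have : \forall t \near U, forall i, f t <> i.
  apply: filter_forall => i.
  by have [/fU|] := in_ultra_setVsetC [set t | f t = i] UU.
by move=> /filter_ex[t /(_ (f t))].
Qed.

Lemma ultra_bounded_cvg (R : realType) n (y : T -> 'rV[R]_n) M :
  (\forall t \near U, `|y t| <= M) -> exists l : 'rV[R]_n, y @ U --> l.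
Proof.
move=> yM; pose K : set 'rV[R]_n := [set v | `|v| <= M].
have Kb : bounded_set K.
  exists M; split; first exact: num_real.
  by move=> N MN v /= /le_trans; apply; exact: ltW.
have Kc : closed K.
  have cont v : (fun w : 'rV[R]_n => `|w|) @ v --> `|v| by exact: norm_continuous.
  exact: (@preimage_closed _ _ _ _ (fun v _ => cont v) (@closed_le R M)).
have [l [_ yl]] := bounded_closed_compact Kb Kc (F := y @ U) _ yM.
exists l => A Al; have [//|yA] := in_ultra_setVsetC (y @^-1` A) UU.
by have [v []] := yl (~` A) A yA Al.
Qed.

(** A family of vectors that does not converge along the ultrafilter tends to
    infinity along it by compactness of balls; rho is the inverse of the norm,
    so that u is a limit of unit vectors. *)
Lemma ultra_cvg_or_direction (R : realType) n (y : T -> 'rV[R]_n) :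
  (exists l : 'rV[R]_n, y @ U --> l) \/
  exists (rho : T -> R) (u : 'rV[R]_n), [/\ u != 0, rho @ U --> 0,
    \forall t \near U, 0 <= rho t & rho t *: y t @[t --> U] --> u].
Proof.
have [[M yM]|/forallNP unb] := pselect (exists M, \forall t \near U, `|y t| <= M).
  by left; exact: ultra_bounded_cvg yM.
right; have inf M : \forall t \near U, M < `|y t|.
  have [/unb//|] := in_ultra_setVsetC [set t | `|y t| <= M] UU.
  by apply: filterS => t /= /negP; rewrite -ltNge.
pose rho t := `|y t|^-1.
have n1 : \forall t \near U, `|rho t *: y t| = 1.
  apply: filterS (inf 0) => t y0.
  by rewrite normrZ ger0_norm ?invr_ge0 // mulVf // gt_eqF.
have [|u yu] := @ultra_bounded_cvg R n (fun t => rho t *: y t) 1.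
  by apply: filterS n1 => t ->.
exists rho, u; split=> //; last by apply: nearW => t; rewrite invr_ge0.
- apply/eqP => u0; rewrite u0 in yu.
  have lt1 : \forall t \near U, `|rho t *: y t| < 1.
    exact: (cvgr0_norm_lt _ yu _ ltr01).
  by have [t [->]] := filter_ex (filterI n1 lt1); rewrite ltxx.
- apply/cvgr0Pnorm_lt => e e0; apply: filterS (inf e^-1) => t yt.
  have y0 : 0 < `|y t| by apply: lt_trans yt; rewrite invr_gt0.
  by rewrite ger0_norm ?invr_ge0 // invf_plt.
Qed.

End UltrafilterLimits.

(** * Affine lattices *)

Section Lattices.
Variables (R : realType) (n : nat).
Implicit Types (L S : set 'rV[R]_n).

(** The coordinates in the lattice basis are continuous and take integer values
    on the lattice. *)
Lemma lattice_discrete L : lattice L ->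
  exists2 e : R, 0 < e & forall x y, L x -> L y -> `|x - y| < e -> x = y.
Proof.
move=> [V Vf ->]; have Vu : V \in unitmx by rewrite -row_free_unit.
pose coord (v : 'rV[R]_n) i := (v *m invmx V) 0 i.
have coordE v i : coord v i = dotp v (row i (invmx V)^T).
  by rewrite /coord mxE; apply: eq_bigr => k _; rewrite !mxE.
have : \forall v \near (0 : 'rV[R]_n), forall i, `|coord v i| < 1.
  apply (@filter_forall _ 'I_n (fun i v => `|coord v i| < 1)
    (nbhs (0 : 'rV[R]_n)) _) => i.
  have c0 : coord v i @[v --> (0 : 'rV[R]_n)] --> (0 : R).
    rewrite (funext (fun v => coordE v i)) -(dotp0l (row i (invmx V)^T)).
    exact: (@cvg_dotp R n _ (nbhs (0 : 'rV[R]_n)) _ id (fun=> _) _ _ _ (cvg_cst _)).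
  exact: (cvgr0_norm_lt _ c0 _ ltr01).
move=> /nbhs_norm0P[e /= e0 he]; exists e => // x y [z _ <-] [z' _ <-] xy.
apply: eq_bigr => i _; congr (_ *~ _); apply/eqP; rewrite -subr_eq0.
have := he _ xy i; set v := _ - _.
have -> : v = (\row_k (z k - z' k)%:~R) *m V.
  rewrite mulmx_sum_row /v -sumrB; apply: eq_bigr => k _.
  by rewrite mxE scaler_int mulrzBr.
rewrite /coord mulmxK // mxE -intr_norm ltrz1 => zz.
by apply/eqP; move: zz; case: (z i - z' i) => [[|k]|k].
Qed.

(** Uniform discreteness makes every subset of a translated lattice closed,
    whatever set truncates it. *)
Lemma truncated_affine_lattice_closed S : truncated_affine_lattice S -> closed S.
Proof.
move=> [L [b [C [/lattice_discrete[e e0 Le] _ _ SE]]]].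
have Sdisc x y : S x -> S y -> `|x - y| < e -> x = y.
  rewrite SE => -[[l Ll <-] _] [[l' Ll' <-] _].
  by rewrite opprD addrACA subrr add0r => /(Le _ _ Ll Ll') ->.
have meet (x : 'rV[R]_n) d : closure S x -> 0 < d -> exists2 s, S s & `|x - s| < d.
  move=> Sx d0; have [s [Ss xs]] := Sx _ (nbhsx_ballx x d d0).
  by exists s => //; move: xs; rewrite -ball_normE.
move=> x Sx; have [s Ss xs] := meet x (e / 2) Sx (divr_gt0 e0 (ltr0Sn _ _)).
have [->//|xs0] := eqVneq x s.
have d0 : 0 < Num.min (e / 2) `|x - s|.
  by rewrite lt_min divr_gt0 //= normr_gt0 subr_eq0.
have [s' Ss'] := meet _ _ Sx d0; rewrite lt_min => /andP[xs' xss'].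
suff s's : s' = s by rewrite s's ltxx in xss'.
apply: Sdisc => //; rewrite -[s' - s](subrKA x) [e]splitr.
by rewrite (le_lt_trans (ler_normD _ _)) // ltrD // distrC.
Qed.

Lemma lineality_lattice_cvg (T : Type) (U : set_system T) (PU : ProperFilter U)
    S (w : T -> 'rV[R]_n) w0 : closed S ->
  (\forall t \near U, lineality_lattice S (w t)) -> w @ U --> w0 ->
  lineality_lattice S w0.
Proof.
move=> Sc Sw ww s Ss z.
apply: (@closed_cvg _ _ _ PU (fun t => s + w t *~ z) S Sc).
  by apply: filterS Sw => t /(_ s Ss z).
apply: cvgD; first exact: cvg_cst.
rewrite -scaler_int; under eq_cvg do rewrite -scaler_int.
by apply: cvgZl_tmp.
Qed.

End Lattices.

(** * The covering property on redundant descriptions *)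

Section CoveringOnDescriptions.
Variables (R : realType) (n m : nat).
Implicit Types (S B : set 'rV[R]_n) (a : 'I_m -> 'rV[R]_n) (J : {set 'I_m}).
Implicit Types (x s r : 'rV[R]_n) (k : 'I_m).

Definition subpolar a J : set 'rV[R]_n :=
  [set x | forall j, j \in J -> dotp (a j) x <= 1].

(** The point x lies in the translate by W_S of the spindle of s based at k,
    where only the normals in J bound the spindle and r = x - w. The set J is
    allowed to contain redundant normals, so that this notion can be passed to
    the limit, where facets may degenerate. *)
Definition covers_at S a J x s r k : Prop :=
  [/\ S s, subpolar a J s, k \in J /\ dotp (a k) s = 1,
      forall j, j \in J ->
        dotp (a j - a k) r <= 0 /\ dotp (a j - a k) (s - r) <= 0 &
      lineality_lattice S (x - r)].

Lemma subpolarE a J :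
  subpolar a J = polar_polyhedron (fun i : 'I_#|J| => a (enum_val i)).
Proof.
rewrite eqEsubset; split=> x xa j; first exact/xa/enum_valP.
by move=> jJ; have := xa (enum_rank_in jJ j); rewrite enum_rankK_in.
Qed.

(** Among the inequalities of c that are tight at s, some one attains the value
    of a valid functional v at r. Otherwise the step from s along
    r - (v . r) s, which keeps v equal to 1, makes every inequality of c strict,
    although v = 1 only holds on the boundary. This replaces a redundant base
    normal v of a spindle by a facet normal. *)
Lemma tight_normal_above p (c : 'I_p -> 'rV[R]_n) v s r :
  polar_polyhedron c s -> (forall x, polar_polyhedron c x -> dotp v x <= 1) ->
  dotp v s = 1 -> (forall i, dotp (c i) r <= dotp v r) ->
  exists2 i, dotp (c i) s = 1 & dotp (c i) r = dotp v r.
Proof.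
move=> cs vc vs cr; apply: contrapT => none.
pose u := r - dotp v r *: s.
have vu : dotp v u = 0 by rewrite dotpBr dotpZr vs mulr1 subrr.
have cu i : dotp (c i) s = 1 -> dotp (c i) u < 0.
  move=> is1; rewrite dotpBr dotpZr is1 mulr1 subr_lt0 lt_neqAle cr andbT.
  by apply/eqP => ir; apply: none; exists i.
have [i|e e0 he] := @small_step R 'I_p (fun i => dotp (c i) s != 1)
    (fun i => dotp (c i) s) (fun i => dotp (c i) u).
  by move=> is1; rewrite lt_neqAle is1 cs.
have lt1 i : dotp (c i) (s + e *: u) < 1.
  rewrite dotpDr dotpZr; have [is1|/he//] := eqVneq (dotp (c i) s) 1.
  by rewrite is1 gtrDl pmulr_rlt0 // cu.
have v0 : v != 0.
  by apply/eqP => v0; move: vs; rewrite v0 dotp0l => /eqP; rewrite eq_sym oner_eq0.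
have [|i] := tight_normal (fun i => ltW (lt1 i)) vc _ v0.
  by rewrite dotpDr dotpZr vs vu mulr0 addr0.
by apply/eqP; rewrite lt_eqF.
Qed.

(** Redundant normals in J only make the spindles smaller, so any J that
    describes B and covers is a witness. From left to right J collects the facet
    normals. From right to left, the spindle conditions for J contain those for
    the facet normals, and a redundant base normal k is exchanged for a facet
    normal. *)
Lemma covering_propertyP S B a : B = polar_polyhedron a ->
  covering_property S B <->
  exists J, B = subpolar a J /\ forall x, exists s r k, covers_at S a J x s r k.
Proof.
move=> BE; split=> [[p [c [[Bc cF _] cov]]]|[J [BJ cov]]].
  pose J := [set i | `[< exists j, c j = a i >]]%SET.
  have cJ j : exists2 i, i \in J & c j = a i.
    have := cF j; rewrite BE => /facet_normal[x|i cE _].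
      by rewrite -BE Bc.
    exists i; last by rewrite cE scale1r.
    by rewrite inE; apply/asboolP; exists j; rewrite cE scale1r.
  have Ja i : i \in J -> exists j, c j = a i by rewrite inE => /asboolP.
  have BJ : B = subpolar a J.
    rewrite eqEsubset; split=> x xB; first by rewrite BE in xB => i _.
    by rewrite Bc => j; have [i iJ ->] := cJ j; exact: xB.
  exists J; split=> // x; have : setT x by [].
  rewrite -cov => -[r [s [Bs Ss] [k /= ks sp]] [w Ww <-]].
  have [i iJ ki] := cJ k; exists s, r, i; split=> //.
  - by rewrite -BJ.
  - by rewrite -ki.
  - by move=> j /Ja[l <-]; rewrite -ki; exact: sp.
  - by rewrite addrC addKr.
have [p [c [cf ca]]] := facet_description_exists (fun i : 'I_#|J| => a (enum_val i)).
rewrite -subpolarE -BJ in cf; have [Bc _ _] := cf.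
have {}ca j : exists2 i, i \in J & c j = a i.
  by have [i ->] := ca j; exists (enum_val i) => //; exact: enum_valP.
exists p, c; split=> //; rewrite eqEsubset; split=> // x _.
have [s [r [k [Ss Js [kJ ks] sp Wx]]]] := cov x.
have cs : polar_polyhedron c s by rewrite -Bc BJ.
have ac y : polar_polyhedron c y -> dotp (a k) y <= 1.
  by rewrite -Bc BJ; apply.
have cr i : dotp (c i) r <= dotp (a k) r.
  by have [l lJ ->] := ca i; have [] := sp l lJ; rewrite dotpBl subr_le0.
have [i is1 ir] := tight_normal_above cs ac ks cr.
exists r; last by exists (x - r) => //; rewrite addrC subrK.
exists s; first by rewrite /= BJ.
exists i => // j; have [l lJ ->] := ca j; have := sp l lJ.
by rewrite !dotpBl !(dotpBr s) is1 ir ks.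
Qed.

End CoveringOnDescriptions.

(** * Maximal S-free sets meet conv S *)

(** If B missed the polyhedron conv S, a hyperplane would separate them with a
    gap, and the half-space of points below conv S would be an S-free set
    strictly larger than B. *)
Lemma maximal_free_meets_hull (R : realType) n (S B : set 'rV[R]_n) :
  polyhedron (convex_hull S) -> S !=set0 -> maximal_free S B ->
  polyhedron B -> B 0 -> (B `&` convex_hull S) !=set0.
Proof.
move=> [p [d [c SE]]] [s0 Ss0] [_ Bmax] [m [a [b BE]]] B0.
apply: contrapT => /set0P/negP/negPn/eqP; rewrite BE SE.
move=> /polyhedra_separation[f [beta [Bf Sf]]].
have {}Sf s : S s -> beta + 1 <= dotp f s.
  move=> /sub_convex_hull; rewrite SE; exact: Sf.
have {}Bf x : B x -> dotp f x <= beta by rewrite BE; exact: Bf.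
have f0 : f != 0.
  apply/eqP => f0; have := Sf _ Ss0; have := Bf _ B0.
  by rewrite f0 !dotp0l => b0; rewrite leNgt => /negP; apply; lra.
have ff := dotp_gt0 f0.
pose H := [set x | dotp f x <= beta + 1].
have Hfree : free_of S H.
  split; first exact: convex_halfspace.
  apply/eqP/negPn/negP => /set0P[s [Hs Ss]].
  have : \forall e \near (0 : R)^'+, H (s + e *: f).
    have : s + e *: f @[e --> (0 : R)^'+] --> s + 0 *: f.
      apply: cvgD; first exact: cvg_cst.
      by apply: cvgZr_tmp; apply: cvg_at_right_filter; exact: cvg_id.
    by rewrite scale0r addr0 => /(_ H Hs).
  move=> /(filterI (nbhs_right_gt (0 : R))) /filter_ex[e [/= e0]].
  rewrite /H /= dotpDr dotpZr => h.
  by have := Sf _ Ss; have := mulr_gt0 e0 ff; lra.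
have BH : B `<=` H by move=> x /Bf /= h; rewrite /H /=; lra.
have HB := Bmax _ Hfree BH.
have : H (((beta + 1) / dotp f f) *: f).
  by rewrite /H /= dotpZr divfK ?gt_eqF.
by rewrite HB => /Bf; rewrite dotpZr divfK ?gt_eqF //; lra.
Qed.

(** * Limits of the covering property *)

Section Limit.
Variables (T : Type) (U : set_system T).
Hypothesis UU : UltraFilter U.
Let PU : ProperFilter U := ultra_proper.
Variables (R : realType) (n m : nat).
Implicit Types (S : set 'rV[R]_n) (J : {set 'I_m}).

Lemma dotp_le_cvg (f y : T -> 'rV[R]_n) (g : T -> R) v z b :
  f @ U --> v -> y @ U --> z -> g @ U --> b ->
  (\forall t \near U, dotp (f t) (y t) <= g t) -> dotp v z <= b.
Proof.
move=> fv yz gb le; rewrite -subr_le0.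
apply: (@closed_cvg _ _ U PU (fun t => dotp (f t) (y t) - g t)
  [set x : R | x <= 0] (@closed_le R 0)).
  by apply: filterS le => t; rewrite /= subr_le0.
by apply: cvgB => //; exact: cvg_dotp.
Qed.

(** If the points s t escaped to infinity, the limit u of their directions would
    give a ray p + l u in B and conv S. So s t converges, to s0 say.
    If the translations w t in W_S escaped, the limit u of their directions
    would give a line s0 + l u in conv S, because s t + z w t lies in S for all
    integers z; the two spindle conditions, rescaled, make all a j . u equal,
    so one half of this line lies in B. Both rays contradict boundedness, and
    once everything converges all the conditions are closed. *)
Lemma covers_at_cvg S (at_ : T -> 'I_m -> 'rV[R]_n) a J x s r k p :
  closed S -> closed (convex_hull S) ->
  bounded_set (subpolar a J `&` convex_hull S) ->
  subpolar a J p -> convex_hull S p ->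
  (forall i, at_ t i @[t --> U] --> a i) ->
  (\forall t \near U, covers_at S (at_ t) J x (s t) (r t) (k t)) ->
  exists s0 r0 k0, covers_at S a J x s0 r0 k0.
Proof.
move=> Sc Hc bd Jp Hp acvg cov.
have /is_convexP Hconv := @convex_hull_convex R n S.
have [k0 kk] := ultra_constant UU k.
have {kk}cov : \forall t \near U, covers_at S (at_ t) J x (s t) (r t) k0.
  by apply: filterS2 cov kk => t + <-.
have cst0 : (fun=> 0 : R) @ U --> (0 : R) by exact: cvg_cst.
have cst1 : (fun=> 1 : R) @ U --> (1 : R) by exact: cvg_cst.
have acvgB j : at_ t j - at_ t k0 @[t --> U] --> a j - a k0 by exact: cvgB.
have [s0 ss] : exists s0 : 'rV[R]_n, s @ U --> s0.
  have [//|[rho [u [u0 rho0 rho_ge0 su]]]] := ultra_cvg_or_direction UU s.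
  have au j : j \in J -> dotp (a j) u <= 0.
    move=> jJ; apply: dotp_le_cvg (acvg j) su rho0 _.
    apply: filterS2 cov rho_ge0 => t [_ /(_ j jJ) js _ _ _] rt.
    by rewrite dotpZr ler_piMr.
  move: u0; suff -> : u = 0 by rewrite eqxx.
  apply: (bounded_ray bd (x := p)) => l l0; split=> [j jJ|].
    rewrite dotpDr dotpZr (le_trans _ (Jp j jJ)) // gerDl.
    by rewrite mulr_ge0_le0 // au.
  have lrho : l * rho t @[t --> U] --> 0.
    by rewrite -(mulr0 l); apply: cvgMl_tmp.
  apply: (@closed_cvg _ _ U PU
    (fun t => (l * rho t) *: s t + (1 - l * rho t) *: p) _ Hc).
    have lrho1 : \forall t \near U, l * rho t < 1.
      exact: (cvgr_lt _ lrho _ ltr01).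
    apply: filterS3 cov rho_ge0 lrho1 => t [Ss _ _ _ _] rt lrt.
    apply: Hconv => //; last exact: sub_convex_hull.
    by rewrite mulr_ge0 // ltW.
  rewrite addrC; apply: cvgD.
    by under eq_cvg do rewrite -scalerA; apply: cvgZl_tmp.
  rewrite -[X in _ --> X]scale1r -[X in X *: p](subr0 1).
  by apply: cvgZr_tmp; apply: cvgB.
have Js0 : subpolar a J s0.
  move=> j jJ; apply: dotp_le_cvg (acvg j) ss cst1 _.
  by apply: filterS cov => t [_ /(_ j jJ)].
pose w t := x - r t.
have rE t : r t = x - w t by rewrite /w subKr.
have [w0 ww] : exists w0 : 'rV[R]_n, w @ U --> w0.
  have [//|[rho [u [u0 rho0 rho_ge0 wu]]]] := ultra_cvg_or_direction UU w.
  have ru : rho t *: r t @[t --> U] --> - u.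
    under eq_cvg do rewrite rE scalerBr.
    rewrite -(sub0r u); apply: cvgB => //.
    by rewrite -(scale0r x); apply: cvgZr_tmp.
  have sru : rho t *: (s t - r t) @[t --> U] --> u.
    under eq_cvg do rewrite scalerBr.
    rewrite -[u]opprK -[- - u]sub0r; apply: cvgB => //.
    by rewrite -(scale0r s0); apply: cvgZ.
  have au j : j \in J -> dotp (a j) u = dotp (a k0) u.
    move=> jJ; apply/le_anti/andP; split; rewrite -subr_le0 -dotpBl.
      apply: dotp_le_cvg (acvgB j) sru cst0 _.
      apply: filterS2 cov rho_ge0 => t [_ _ _ /(_ j jJ)[_ h] _] rt.
      by rewrite dotpZr mulr_ge0_le0.
    rewrite -opprB dotpNl -dotpNr; apply: dotp_le_cvg (acvgB j) ru cst0 _.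
    apply: filterS2 cov rho_ge0 => t [_ _ _ /(_ j jJ)[h _] _] rt.
    by rewrite dotpZr mulr_ge0_le0.
  have line l : convex_hull S (s0 + l *: u).
    have lrho : l * rho t @[t --> U] --> 0.
      by rewrite -(mulr0 l); apply: cvgMl_tmp.
    apply: (@closed_cvg _ _ U PU (fun t => s t + (l * rho t) *: w t) _ Hc).
      have lrho1 : \forall t \near U, `|l * rho t| < 1.
        exact: (cvgr0_norm_lt _ lrho _ ltr01).
      apply: filterS2 cov lrho1 => t [Ss _ _ _ Ww].
      rewrite ltr_norml => /andP[lr1 lr2]; set q := l * rho t in lr1 lr2 *.
      (* The real multiple q of w t is averaged from the integers 1 and -1. *)
      have -> : s t + q *: w t = ((1 + q) / 2) *: (s t + w t *~ 1) +
          (1 - (1 + q) / 2) *: (s t + w t *~ (-1)).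
        rewrite mulrN1z mulr1z; apply/rowP => i; rewrite !mxE; lra.
      by apply: Hconv; [apply/andP; split; lra|apply: sub_convex_hull; exact: Ww..].
    apply: cvgD => //.
    by under eq_cvg do rewrite -scalerA; apply: cvgZl_tmp.
  have ray e : dotp (a k0) (e *: u) <= 0 -> e *: u = 0.
    move=> eu; apply: (bounded_ray bd (x := s0)) => l l0; split=> [j jJ|].
      rewrite dotpDr !dotpZr au // -dotpZr (le_trans _ (Js0 j jJ)) // gerDl.
      by rewrite mulr_ge0_le0.
    by rewrite scalerA; exact: line.
  move: u0; suff -> : u = 0 by rewrite eqxx.
  have [uk|uk] := leP (dotp (a k0) u) 0.
    by have := ray 1; rewrite scale1r; apply.
  apply: oppr_inj; rewrite oppr0 -scaleN1r; apply: ray.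
  by rewrite scaleN1r dotpNr oppr_le0 ltW.
have rr : r @ U --> x - w0.
  by rewrite (funext rE); apply: cvgB => //; exact: cvg_cst.
have srr : s t - r t @[t --> U] --> s0 - (x - w0) by exact: cvgB.
exists s0, (x - w0), k0; split=> //.
- apply: (@closed_cvg _ _ U PU s S Sc) => //.
  by apply: filterS cov => t [].
- have [t [_ _ [k0J _] _ _]] := filter_ex cov; split=> //.
  apply/eqP; rewrite eq_le Js0 //= -lerN2 -dotpNl.
  apply: (dotp_le_cvg (g := fun=> - 1) _ ss (cvg_cst _)).
    by apply: cvgN; exact: acvg.
  by apply: filterS cov => t' [_ _ [_ h] _ _]; rewrite dotpNl h.
- move=> j jJ; split.
    apply: dotp_le_cvg (acvgB j) rr cst0 _.
    by apply: filterS cov => t [_ _ _ /(_ j jJ)[]].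
  apply: dotp_le_cvg (acvgB j) srr cst0 _.
  by apply: filterS cov => t [_ _ _ /(_ j jJ)[]].
- rewrite subKr; apply: (lineality_lattice_cvg PU Sc _ ww).
  by apply: filterS cov => t [].
Qed.

(** An inequality outside J may be redundant for each t and tight in the limit,
    but it stays redundant: shrinking x towards 0 gives room for the
    perturbation of the normals. *)
Lemma polar_cvg_subpolar (at_ : T -> 'I_m -> 'rV[R]_n) a J :
  (forall i, at_ t i @[t --> U] --> a i) ->
  (\forall t \near U, polar_polyhedron (at_ t) = subpolar (at_ t) J) ->
  polar_polyhedron a = subpolar a J.
Proof.
move=> acvg aJ; rewrite eqEsubset; split=> x xa; first by move=> j _; exact: xa.
move=> i; apply: contrapT => /negP; rewrite -ltNge => ix.
(* With l strictly between 1 / (a i . x) and 1, the point l x is strictly inside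
   all inequalities of J and still violates that of i. *)
pose l := 2 / (1 + dotp (a i) x).
have l0 : 0 < l by rewrite divr_gt0 //; lra.
have l1 : l < 1 by rewrite ltr_pdivrMr; lra.
have lx : 1 < dotp (a i) (l *: x).
  by rewrite dotpZr /l mulrAC ltr_pdivlMr; lra.
have cvgx j : dotp (at_ t j) (l *: x) @[t --> U] --> dotp (a j) (l *: x).
  by apply: cvg_dotp => //; exact: cvg_cst.
have near1 : \forall t \near U, forall j, j \in J -> dotp (at_ t j) (l *: x) < 1.
  apply: filter_forall => j; have [jJ|] := boolP (j \in J); last first.
    by move=> _; apply: nearW.
  have jx : dotp (a j) (l *: x) < 1.
    rewrite dotpZr (le_lt_trans _ l1) // ger_pMr //; exact: xa.
  by apply: filterS (cvgr_lt _ (cvgx j) _ jx) => t ht _.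
have neari : \forall t \near U, 1 < dotp (at_ t i) (l *: x).
  exact: (cvgr_gt _ (cvgx i) _ lx).
have [t [[+ ht] hi]] := filter_ex (filterI (filterI aJ near1) neari).
move=> /(congr1 (fun A => A (l *: x))) E.
have : polar_polyhedron (at_ t) (l *: x) by rewrite E => j /ht/ltW.
by move=> /(_ i); rewrite leNgt hi.
Qed.

End Limit.

Unset Implicit Arguments.
Set Strict Implicit.

Theorem theorem5p7 (R : realType) (n : nat) (S : set 'rV[R]_n)
    (Bt : nat -> set 'rV[R]_n) (B : set 'rV[R]_n) :
  polyhedrally_truncated_affine_lattice S ->
  (forall t, [/\ maximal_free S (Bt t), interior (Bt t) 0 &
                 covering_property S (Bt t)]) ->
  maximal_free S B ->
  interior B 0 ->
  polyhedra_cvg Bt B ->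
  polytope (B `&` convex_hull S) ->
  covering_property S B.
Proof.
move=> [/truncated_affine_lattice_closed Sc Sh] HBt Bmax /interior_subset B0.
move=> [m [at_ [a [BtE BE acvg]]]] [_ bd].
have [U [UU Uoo]] := ultraFilterLemma (@eventually_filter).
have {}acvg i : at_ t i @[t --> U] --> a i by move=> A /(acvg i) /Uoo.
have /choice[J HJ] : forall t, exists J,
    polar_polyhedron (at_ t) = subpolar (at_ t) J /\
    forall x, exists s r k, covers_at S (at_ t) J x s r k.
  by move=> t; have [_ _ /(covering_propertyP S (BtE t))] := HBt t; rewrite BtE.
have [J0 JJ] := ultra_constant UU J.
have BJ : B = subpolar a J0.
  rewrite BE; apply: polar_cvg_subpolar acvg _ => //.
  by apply: filterS JJ => t <-; case: (HJ t).
apply/(covering_propertyP S BE); exists J0; split=> // x.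
have /choice[srk Hsrk] : forall t, exists srk : 'rV[R]_n * 'rV[R]_n * 'I_m,
    covers_at S (at_ t) (J t) x srk.1.1 srk.1.2 srk.2.
  by move=> t; have [_ /(_ x)[s [r [k h]]]] := HJ t; exists (s, r, k).
have [p [Bp Hp]] : (B `&` convex_hull S) !=set0.
  apply: maximal_free_meets_hull => //.
    by case: (Hsrk 0%N); exists (srk 0%N).1.1.
  by exists m, a, (fun=> 1).
rewrite BJ in bd Bp.
apply: (covers_at_cvg UU (s := fun t => (srk t).1.1) (r := fun t => (srk t).1.2)
  (k := fun t => (srk t).2) Sc (polyhedron_closed Sh) bd Bp Hp acvg).
by apply: filterS JJ => t <-; exact: Hsrk.
Qed.
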